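(* Let $Q$ be a finite loop. If there is a normal subloop $N$ of $Q$ such that $|N|$ is odd and $Q/N\cong\mathbb{Z}_{2^m}$ for some $m\geq 1$, then $Q$ has no regular row $k$-plex for any odd $k\ge 1$.
   Context: A loop is a set $Q$ with a binary operation and a neutral element $1$ such that for all $x,z\in Q$ the equations $x\cdot y_1=z$ and $y_2\cdot x=z$ have unique solutions $y_1,y_2\in Q$. Write $L_x(y)=xy$ and $R_x(y)=yx$. The inner mappings of $Q$ are $L(x,y)=L_{yx}^{-1}L_yL_x$, $R(x,y)=R_{xy}^{-1}R_yR_x$ and $T(x)=R_x^{-1}L_x$. A subloop is normal if it is invariant under all inner mappings. The multiplication table of $Q$ is $\{(x,y,xy):x,y\in Q\}$; in a triple $(x,y,z)$, $x$ is the row, $y$ the column and $z$ the entry. A regular row $k$-plex of $Q$ is a collection $C$ of triples in the multiplication table such that each element of $Q$ appears as a row precisely $k$ times and every $s\in Q$ appears as a column of triples in $C$ the same number of times as it appears as an entry of triples in $C$. $\mathbb{Z}_{2^m}$ is the cyclic group of order $2^m$. *)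

(* Defs.v *)
From HB Require Import structures.
From mathcomp Require Import all_boot all_order all_algebra all_fingroup.

Set Implicit Arguments.
Unset Strict Implicit.
Unset Printing Implicit Defensive.

Declare Scope loop_scope.
Delimit Scope loop_scope with L.
Local Open Scope loop_scope.

(* The umagmaType of MathComp is not reused: its join with Finite conflicts   *)
(* with the finite group hierarchy, which provides {perm Q} below.            *)
HB.mixin Record isLoop Q := {
  lmul : Q -> Q -> Q;
  lone : Q;
  lmul1l : left_id lone lmul;
  lmull1 : right_id lone lmul;
  ldiv_uniq : forall x z : Q, exists! y : Q, lmul x y = z;
  rdiv_uniq : forall x z : Q, exists! y : Q, lmul y x = z
}.

#[short(type="loopType")]
HB.structure Definition Loop := {Q of isLoop Q}.

#[short(type="finLoopType")]
HB.structure Definition FinLoop := {Q of Finite Q & isLoop Q}.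

Bind Scope loop_scope with Loop.sort.
Bind Scope loop_scope with FinLoop.sort.

Notation "x * y" := (lmul x y) : loop_scope.
Notation "1" := (@lone _) : loop_scope.

Definition loop_isog (G H : loopType) : Prop :=
  exists2 f : G -> H, bijective f & {morph f : x y / x * y >-> x * y}.

(* The cyclic group of integers modulo n.+1, under addition, as a loop. In    *)
(* particular this makes 'Z_n a loop.                                         *)
Section CyclicLoop.

Variable n : nat.
Implicit Types x z : 'I_n.+1.

Lemma Zp_ldiv_uniq x z : exists! y : 'I_n.+1, (x + y)%R = z.
Proof.
exists (z - x)%R; split; first by rewrite GRing.addrC GRing.subrK.
by move=> y <-; rewrite GRing.addrC GRing.addKr.
Qed.

Lemma Zp_rdiv_uniq x z : exists! y : 'I_n.+1, (y + x)%R = z.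
Proof.
by exists (z - x)%R; split=> [|y <-]; rewrite ?GRing.subrK ?GRing.addrK.
Qed.

HB.instance Definition _ :=
  isLoop.Build 'I_n.+1 (@GRing.add0r _) (@GRing.addr0 _)
    Zp_ldiv_uniq Zp_rdiv_uniq.

End CyclicLoop.

Section Translations.

Variable Q : finLoopType.
Implicit Types x y z : Q.

Lemma loop_mulI x : injective (fun y => x * y).
Proof.
move=> y z eq_xyz; have [w [_ uniq_w]] := ldiv_uniq x (x * z).
by rewrite -(uniq_w y eq_xyz) -(uniq_w z).
Qed.

Lemma loop_mulIr x : injective (fun y => y * x).
Proof.
move=> y z eq_yzx; have [w [_ uniq_w]] := rdiv_uniq x (z * x).
by rewrite -(uniq_w y eq_yzx) -(uniq_w z).
Qed.

Definition ltrans x : {perm Q} := perm (@loop_mulI x).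
Definition rtrans x : {perm Q} := perm (@loop_mulIr x).

(* Products in {perm Q} are read from left to right: (s * t) z = t (s z), so  *)
(* L(x, y) = L_{yx}^-1 L_y L_x is written with its factors reversed, and      *)
(* similarly for R(x, y) and T(x).                                            *)
Definition inner_L x y : {perm Q} :=
  (ltrans x * ltrans y * (ltrans (y * x)%L)^-1)%g.
Definition inner_R x y : {perm Q} :=
  (rtrans x * rtrans y * (rtrans (x * y)%L)^-1)%g.
Definition inner_T x : {perm Q} := (ltrans x * (rtrans x)^-1)%g.

Definition is_subloop (N : {set Q}) : Prop :=
  [/\ 1 \in N,
      {in N &, forall x y, x * y \in N},
      {in N &, forall x z, exists2 y, y \in N & x * y = z}
    & {in N &, forall x z, exists2 y, y \in N & y * x = z}].

Definition is_normal_subloop (N : {set Q}) : Prop :=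
  [/\ is_subloop N,
      forall x y, inner_L x y @: N = N,
      forall x y, inner_R x y @: N = N
    & forall x, inner_T x @: N = N].

Record normalSubloop := NormalSubloop {
  nsubloop_set :> {set Q};
  nsubloopP : is_normal_subloop nsubloop_set
}.

End Translations.

Section Quotient.

Variables (Q : finLoopType) (N : normalSubloop Q).
Implicit Types (x y z : Q) (A B : {set Q}).

Definition loop_cosets : {set {set Q}} := [set ltrans x @: N | x : Q].

Definition loop_setmul A B : {set Q} := [set a * b | a in A, b in B].

Lemma perm_imset_mulV (s t : {perm Q}) :
  (s * t^-1)%g @: N = N -> s @: N = t @: N.
Proof.
move=> stN; rewrite -{2}stN -imset_comp; apply: eq_imset => z /=.
by rewrite permM permKV.
Qed.

Lemma perm_imsetM (s t : {perm Q}) A : (s * t)%g @: A = t @: (s @: A).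
Proof. by rewrite -imset_comp; apply: eq_imset => z /=; rewrite permM. Qed.

Lemma nsubloop_T x : ltrans x @: N = rtrans x @: N.
Proof. by case: (nsubloopP N) => _ _ _ NT; apply: perm_imset_mulV (NT x). Qed.

Lemma nsubloop_L x y : ltrans (y * x) @: N = ltrans y @: (ltrans x @: N).
Proof.
case: (nsubloopP N) => _ NL _ _.
by rewrite -(perm_imset_mulV (NL x y)) perm_imsetM.
Qed.

Lemma nsubloop_R x y : rtrans (x * y) @: N = rtrans y @: (rtrans x @: N).
Proof.
case: (nsubloopP N) => _ _ NR _.
by rewrite -(perm_imset_mulV (NR x y)) perm_imsetM.
Qed.

Lemma ltrans_nsubloop n : n \in N -> ltrans n @: N = N.
Proof.
move=> Nn; case: (nsubloopP N) => [[_ NM _ _] _ _ _].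
apply/eqP; rewrite eqEcard card_imset ?leqnn ?andbT; last exact: perm_inj.
by apply/subsetP=> _ /imsetP[z Nz ->]; rewrite permE NM.
Qed.

Lemma ltrans_coset x w : w \in ltrans x @: N -> ltrans w @: N = ltrans x @: N.
Proof.
by case/imsetP=> n Nn ->; rewrite permE nsubloop_L ltrans_nsubloop.
Qed.

Lemma mem_ltrans_coset x : x \in ltrans x @: N.
Proof.
case: (nsubloopP N) => [[N1 _ _ _] _ _ _].
by apply/imsetP; exists 1; rewrite ?permE ?lmull1.
Qed.

Lemma loop_setmul_cosets x y :
  loop_setmul (ltrans x @: N) (ltrans y @: N) = ltrans (x * y) @: N.
Proof.
have eq_xyN a : a \in ltrans x @: N -> ltrans (a * y) @: N = ltrans (x * y) @: N.
  move=> xNa; apply: ltrans_coset.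
  rewrite nsubloop_T nsubloop_R -nsubloop_T.
  by apply/imsetP; exists a; rewrite ?permE.
apply/setP=> z; apply/imset2P/idP.
  move=> [a b xNa yNb ->]; rewrite -(eq_xyN a xNa) nsubloop_L.
  by apply/imsetP; exists b; rewrite ?permE.
rewrite nsubloop_L => /imsetP[b yNb ->].
by exists x b; rewrite ?permE ?mem_ltrans_coset.
Qed.

Lemma loop_cosetsM A B :
  A \in loop_cosets -> B \in loop_cosets -> loop_setmul A B \in loop_cosets.
Proof.
case/imsetP=> x _ -> /imsetP[y _ ->].
by rewrite loop_setmul_cosets; apply: imset_f.
Qed.

Lemma nsubloop_in_cosets : (N : {set Q}) \in loop_cosets.
Proof.
case: (nsubloopP N) => [[N1 _ _ _] _ _ _].
by apply/imsetP; exists 1; rewrite ?ltrans_nsubloop.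
Qed.

Definition quotient_loop := {A : {set Q} | A \in loop_cosets}.

HB.instance Definition _ := SubFinite.on quotient_loop.

Definition quotient_mul (A B : quotient_loop) : quotient_loop :=
  Sub (loop_setmul (val A) (val B)) (loop_cosetsM (valP A) (valP B)).

Definition quotient_one : quotient_loop :=
  Sub (N : {set Q}) nsubloop_in_cosets.

Definition quotient_proj x : quotient_loop :=
  Sub (ltrans x @: N) (imset_f (fun x => ltrans x @: N) isT).

Lemma quotient_projP (A : quotient_loop) : exists x, A = quotient_proj x.
Proof.
by case: A => A cosA; case/imsetP: (cosA) => x _ defA; exists x; apply: val_inj.
Qed.

Lemma quotient_projM x y :
  quotient_mul (quotient_proj x) (quotient_proj y) = quotient_proj (x * y).
Proof. by apply: val_inj; rewrite /= loop_setmul_cosets. Qed.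

Lemma quotient_proj1 : quotient_proj 1 = quotient_one.
Proof.
by apply: val_inj; rewrite /= ltrans_nsubloop; case: (nsubloopP N) => [[]].
Qed.

Lemma quotient_mul1 : left_id quotient_one quotient_mul.
Proof.
by move=> A; have [x ->] := quotient_projP A;
   rewrite -quotient_proj1 quotient_projM lmul1l.
Qed.

Lemma quotient_mulr1 : right_id quotient_one quotient_mul.
Proof.
by move=> A; have [x ->] := quotient_projP A;
   rewrite -quotient_proj1 quotient_projM lmull1.
Qed.

Lemma quotient_ldiv (A C : quotient_loop) :
  exists! B : quotient_loop, quotient_mul A B = C.
Proof.
have [[x ->] [z ->]] := (quotient_projP A, quotient_projP C).
have [y [xy_z _]] := ldiv_uniq x z.
exists (quotient_proj y); split; first by rewrite -xy_z; apply: quotient_projM.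
move=> B; have [w ->] := quotient_projP B.
rewrite -xy_z quotient_projM => /(congr1 val) /=.
rewrite !nsubloop_L => eq_wy; apply: val_inj => /=.
exact: esym (imset_inj (@perm_inj _ (ltrans x)) eq_wy).
Qed.

Lemma quotient_rdiv (A C : quotient_loop) :
  exists! B : quotient_loop, quotient_mul B A = C.
Proof.
have [[x ->] [z ->]] := (quotient_projP A, quotient_projP C).
have [y [yx_z _]] := rdiv_uniq x z.
exists (quotient_proj y); split; first by rewrite -yx_z; apply: quotient_projM.
move=> B; have [w ->] := quotient_projP B.
rewrite -yx_z quotient_projM => /(congr1 val) /=.
rewrite !nsubloop_T !nsubloop_R => eq_wy; apply: val_inj => /=.
by rewrite !nsubloop_T (imset_inj (@perm_inj _ (rtrans x)) eq_wy).
Qed.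

HB.instance Definition _ :=
  isLoop.Build quotient_loop quotient_mul1 quotient_mulr1
    quotient_ldiv quotient_rdiv.

End Quotient.

Section Plexes.

Variable Q : finLoopType.

(* A triple (x, y, z) is ((x, y), z): its row is t.1.1, its column t.1.2 and  *)
(* its entry t.2.                                                             *)
Definition mul_table : {set Q * Q * Q} := [set (x, y, x * y) | x : Q, y : Q].

Definition regular_row_plex (k : nat) (C : {set Q * Q * Q}) : Prop :=
  [/\ C \subset mul_table,
      forall x : Q, #|[set t in C | t.1.1 == x]| = k
    & forall s : Q,
        #|[set t in C | t.1.2 == s]| = #|[set t in C | t.2 == s]|].

End Plexes.

(* Main.v *)
(* A homomorphism f from Q to an abelian group, summed over the triples of a  *)
(* regular row k-plex, gives (sum of rows) + (sum of columns) = (sum of       *)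
(* entries). The last two sums agree by regularity, so k copies of the sum of *)
(* f over Q vanish. For the projection onto Z_{2^m} that multiple is          *)
(* k |N| 2^(m-1) (2^m - 1), which 2^m does not divide when k and |N| are odd. *)
Require Import Defs.
From mathcomp Require Import all_boot all_order all_algebra all_fingroup.

(** Let f be the projection to Q/N followed by the isomorphism. A plex forces k times the sum of f
    to vanish ([regular_row_plex_sum]). All fibres of f have size |N| ([card_quotient_proj_fiber]),
    so k |N| kills the sum of the elements of Z_{2^m}. That sum is nonzero ([sum_Zp],
    [dvdn_exp2_bin2]), and k |N| is odd, hence invertible modulo 2^m. *)

Lemma sum_fiber_card (V : nmodType) (S T : finType) (P : pred S)
    (g : S -> T) (f : T -> V) :
  (\sum_(x | P x) f (g x) = \sum_(s : T) f s *+ #|[set x | P x & g x == s]|)%R.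
Proof.
rewrite (partition_big g xpredT) //=; apply: eq_bigr => s _.
rewrite (eq_bigr (fun=> f s)) => [|x /andP[_ /eqP ->] //].
by rewrite GRing.sumr_const cardsE.
Qed.

Lemma regular_row_plex_sum (Q : finLoopType) (V : zmodType) (f : Q -> V)
    (k : nat) (C : {set Q * Q * Q}) :
  (forall x y : Q, f (lmul x y) = (f x + f y)%R) ->
  regular_row_plex k C -> ((\sum_(x : Q) f x) *+ k = 0)%R.
Proof.
move=> fM [/subsetP sCM rowC colC].
have sumC : (\sum_(t in C) f t.2 =
             \sum_(t in C) f t.1.1 + \sum_(t in C) f t.1.2)%R.
  rewrite -big_split /=; apply: eq_bigr => t /sCM /imset2P[x y _ _ ->].
  exact: fM.
have col_entry : (\sum_(t in C) f t.1.2 = \sum_(t in C) f t.2)%R.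
  rewrite (sum_fiber_card _ _ _ (mem C) (fun t => t.1.2)).
  rewrite (sum_fiber_card _ _ _ (mem C) snd).
  by apply: eq_bigr => s _; rewrite colC.
have row_sum : (\sum_(t in C) f t.1.1 = (\sum_(x : Q) f x) *+ k)%R.
  rewrite (sum_fiber_card _ _ _ (mem C) (fun t => t.1.1)) -GRing.sumrMnl.
  by apply: eq_bigr => s _; rewrite rowC.
apply: (GRing.addIr (\sum_(t in C) f t.1.2)%R).
by rewrite -row_sum -sumC GRing.add0r.
Qed.

(** The fibre over the coset of [a] is that coset, the image of N under a permutation. *)
Lemma card_quotient_proj_fiber (Q : finLoopType) (N : normalSubloop Q)
    (A : quotient_loop N) :
  #|[set x | quotient_proj N x == A]| = #|N|.
Proof.
have [a ->] := quotient_projP A.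
suff -> : [set x | quotient_proj N x == quotient_proj N a] = ltrans a @: N.
  exact/card_imset/perm_inj.
apply/setP=> x; rewrite inE -val_eqE /=; apply/eqP/idP => [<-|].
  exact: mem_ltrans_coset.
exact: ltrans_coset.
Qed.

Lemma sum_Zp (n : nat) : 1 < n -> (\sum_(z : 'Z_n) z = ('C(n, 2))%:R :> 'Z_n)%R.
Proof.
(* The type ['Z_n] is truncated to have at least two elements; exposing two successors makes its
   size n by computation. *)
case: n => [|[|n]] // _.
rewrite -bin2_sum big_mkord GRing.natr_sum.
by apply: eq_bigr => i _; rewrite natr_Zp.
Qed.

Lemma natr_Zp_eq0 (n a : nat) : 1 < n -> ((a%:R : 'Z_n) == 0)%R = (n %| a).
Proof. by move=> n_gt1; rewrite -val_eqE /= val_Zp_nat. Qed.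

(** With n = 2^m, 2 C(n, 2) = n (n - 1), so n divides C(n, 2) only if 2 divides n - 1, which is
    odd. *)
Lemma dvdn_exp2_bin2 (m : nat) : 0 < m -> (2 ^ m %| 'C(2 ^ m, 2)) = false.
Proof.
move=> m_gt0; have n_gt0 : 0 < 2 ^ m by rewrite expn_gt0.
have n_even : odd (2 ^ m) = false by rewrite oddX eqn0Ngt m_gt0.
rewrite -(dvdn_pmul2l (ltn0Sn 1)) -mul_bin_diag bin1 mulnC dvdn_pmul2l //.
by rewrite dvdn2 -[_.-1]subn1 oddB // n_even.
Qed.

Theorem corollary8 (Q : finLoopType) :
  (exists (N : normalSubloop Q) (m : nat),
     [/\ odd #|N|, 1 <= m & loop_isog (quotient_loop N) 'Z_(2 ^ m)]) ->
  forall k : nat, 1 <= k -> odd k ->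
  ~ exists C : {set Q * Q * Q}, regular_row_plex k C.
Proof.
case=> N [m [odd_N m_gt0 [h h_bij hM]]] k _ odd_k [C plexC].
have n_gt1 : 1 < 2 ^ m by rewrite -{1}(expn0 2) ltn_exp2l.
have fM (x y : Q) : (h (quotient_proj N (lmul x y)) =
    h (quotient_proj N x) + h (quotient_proj N y))%R.
  by rewrite -quotient_projM; apply: hM.
have := regular_row_plex_sum _ _ _ _ _ fM plexC.
rewrite (sum_fiber_card _ _ _ xpredT) /=.
under eq_bigr => A _ do rewrite card_quotient_proj_fiber.
rewrite GRing.sumrMnl -(reindex h (P := xpredT) (F := id)) /=; last exact: onW_bij.
rewrite sum_Zp // => /eqP.
rewrite -!GRing.mulrnA natr_Zp_eq0 //.
(* The factors |N| and k are odd, so coprime to 2^m, and cancel. *)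
rewrite Gauss_dvdl ?dvdn_exp2_bin2 //.
by rewrite coprimeXl // coprime2n oddM odd_N.
Qed.
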